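(* Let $\mathcal{K}_1,\mathcal{K}_2$ be consistent $\mathcal{ALC}$ KBs and $\Sigma$ a signature. Then $\mathcal{K}_1$ $\Sigma$-UCQ entails $\mathcal{K}_2$ if and only if for every model $\mathcal{I}_1$ of $\mathcal{K}_1$ there exists a model $\mathcal{I}_2$ of $\mathcal{K}_2$ that is $\Sigma$-homomorphically embeddable into $\mathcal{I}_1$.
   Context: A KB is $\mathcal{K}=(\mathcal{T},\mathcal{A})$ with $\mathcal{T}$ an $\mathcal{ALC}$ TBox and $\mathcal{A}$ an ABox of assertions $A(a)$, $R(a,b)$; $\mathsf{ind}(\mathcal{K})$ its individuals; interpretations satisfy $a^{\mathcal{I}}=a$. A UCQ is a disjunction of CQs $\exists\vec y\,\varphi(\vec x,\vec y)$ (conjunctions of atoms $A(z)$, $R(z,z')$) with the same answer variables; $\mathcal{K}\models q(\vec a)$ means all models satisfy $q(\vec a)$. $\mathcal{K}_1$ $\Sigma$-UCQ entails $\mathcal{K}_2$ if for every UCQ $q(\vec x)$ over names in $\Sigma$ and tuple $\vec a$ from $\mathsf{ind}(\mathcal{K}_2)$, $\mathcal{K}_2\models q(\vec a)$ implies $\vec a\subseteq\mathsf{ind}(\mathcal{K}_1)$ and $\mathcal{K}_1\models q(\vec a)$. $\mathcal{I}_2$ is $\Sigma$-homomorphically embeddable into $\mathcal{I}_1$ if there is a map $h:\Delta^{\mathcal{I}_2}\to\Delta^{\mathcal{I}_1}$ with $u\in A^{\mathcal{I}_2}\Rightarrow h(u)\in A^{\mathcal{I}_1}$ and $(u,v)\in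 R^{\mathcal{I}_2}\Rightarrow(h(u),h(v))\in R^{\mathcal{I}_1}$ for all $\Sigma$-concept names $A$ and $\Sigma$-role names $R$, and $h(a)=a$ for all $a\in\mathsf{ind}(\mathcal{K}_2)$. *)

(* Defs.v *)
From Stdlib Require List.
From mathcomp Require Import all_boot.
From mathcomp Require Import boolp classical_sets.
Set Implicit Arguments.
Unset Strict Implicit.
Unset Printing Implicit Defensive.

Local Open Scope classical_set_scope.

Definition concept_name : Type := nat.
Definition role_name : Type := nat.
Definition ind_name : Type := nat.

Inductive concept : Type :=
| CTop
| CBot
| CName of concept_name
| CNot of concept
| CAnd of concept & concept
| COr of concept & concept
| CEx of role_name & concept
| CAll of role_name & concept.

(* A pair (C, D) is the concept inclusion C ⊑ D. *)
Definition tbox : Type := seq (concept * concept).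

Inductive assertion : Type :=
| CAssert of concept_name & ind_name
| RAssert of role_name & ind_name & ind_name.

Definition abox : Type := seq assertion.

Record kb : Type := KB { kb_tbox : tbox; kb_abox : abox }.

Definition assertion_inds (f : assertion) : seq ind_name :=
  match f with
  | CAssert _ a => [:: a]
  | RAssert _ a b => [:: a; b]
  end.

Definition ind (K : kb) : seq ind_name :=
  flatten (map assertion_inds (kb_abox K)).

(* Standard name assumption: the domain is a nonempty set of individual names
   [inl a] and further elements [inr x], and the individual a denotes [inl a].
   An individual name need not belong to the domain; those of ind(K) do in
   every model of K, because extensions are subsets of the domain. *)
Record interp : Type := Interp {
  anon : Type;
  dom : set (ind_name + anon);
  cint : concept_name -> set (ind_name + anon);
  rint : role_name -> (ind_name + anon) -> (ind_name + anon) -> Prop;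
  dom_nonempty : dom !=set0;
  cint_dom : forall A, cint A `<=` dom;
  rint_dom : forall R u v, rint R u v -> dom u /\ dom v }.

Definition elt (I : interp) : Type := (ind_name + anon I)%type.

Definition named (I : interp) (a : ind_name) : elt I := inl a.

Fixpoint ext (I : interp) (C : concept) : set (elt I) :=
  match C with
  | CTop => @dom I
  | CBot => set0
  | CName A => @cint I A
  | CNot C => @dom I `\` @ext I C
  | CAnd C D => @ext I C `&` @ext I D
  | COr C D => @ext I C `|` @ext I D
  | CEx R C => [set u | exists v, rint R u v /\ @ext I C v]
  | CAll R C => [set u | dom u /\ forall v, rint R u v -> @ext I C v]
  end.

Arguments ext : clear implicits.

Definition sat_assertion (I : interp) (f : assertion) : Prop :=
  match f with
  | CAssert A a => cint A (named I a)
  | RAssert R a b => rint R (named I a) (named I b)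
  end.

Definition model (I : interp) (K : kb) : Prop :=
  (forall C D, List.In (C, D) (kb_tbox K) -> ext I C `<=` ext I D) /\
  (forall f, List.In f (kb_abox K) -> sat_assertion I f).

Definition consistent (K : kb) : Prop := exists I, model I K.

Record signature : Type := Signature {
  sig_concepts : set concept_name;
  sig_roles : set role_name }.

(* Variables of a query with answer variables x_0, ..., x_(n-1); every
   variable [YVar k] is existentially quantified. *)
Inductive qvar (n : nat) : Type :=
| XVar of 'I_n
| YVar of nat.

Inductive atom (n : nat) : Type :=
| CAtom of concept_name & qvar n
| RAtom of role_name & qvar n & qvar n.

(* A CQ is the list of its conjuncts, a UCQ the list of its disjuncts.  An
   answer variable need not occur in an atom: the empty conjunction is true. *)
Definition cq (n : nat) : Type := seq (atom n).
Definition ucq (n : nat) : Type := seq (cq n).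

Definition atom_over (S : signature) (n : nat) (t : atom n) : Prop :=
  match t with
  | CAtom A _ => sig_concepts S A
  | RAtom R _ _ => sig_roles S R
  end.

Definition ucq_over (S : signature) (n : nat) (q : ucq n) : Prop :=
  forall p, List.In p q -> forall t, List.In t p -> atom_over S t.

Definition sat_atom (I : interp) (n : nat) (pi : qvar n -> elt I)
    (t : atom n) : Prop :=
  match t with
  | CAtom A z => cint A (pi z)
  | RAtom R z z' => rint R (pi z) (pi z')
  end.

Definition sat_cq (I : interp) (n : nat) (p : cq n) (a : n.-tuple ind_name) :
    Prop :=
  exists pi : qvar n -> elt I,
    [/\ forall z, dom (pi z),
        forall i, pi (XVar i) = named I (tnth a i)
      & forall t, List.In t p -> sat_atom pi t].

Definition sat_ucq (I : interp) (n : nat) (q : ucq n) (a : n.-tuple ind_name) :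
    Prop :=
  exists2 p, List.In p q & sat_cq I p a.

Definition entails (K : kb) (n : nat) (q : ucq n) (a : n.-tuple ind_name) :
    Prop :=
  forall I, model I K -> sat_ucq I q a.

Definition ucq_entails (S : signature) (K1 K2 : kb) : Prop :=
  forall (n : nat) (q : ucq n) (a : n.-tuple ind_name),
    ucq_over S q -> {subset a <= ind K2} ->
    entails K2 q a -> {subset a <= ind K1} /\ entails K1 q a.

Definition hom_embeddable (S : signature) (K2 : kb) (I2 I1 : interp) : Prop :=
  exists h : elt I2 -> elt I1,
    [/\ forall u, dom u -> dom (h u),
        forall A u, sig_concepts S A -> cint A u -> cint A (h u),
        forall R u v, sig_roles S R -> rint R u v -> rint R (h u) (h v)
      & forall a, a \in ind K2 -> h (named I2 a) = named I1 a].

(* Main.v *)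
Require Import Defs.
From HB Require Import structures.
From mathcomp Require Import all_boot.
From mathcomp Require Import boolp.
Set Implicit Arguments.
Unset Strict Implicit.
Unset Printing Implicit Defensive.

(** A homomorphism carries the matches of a query along, which gives one direction;
    the individuals of [K2] lie in [K1] because some model of [K1] contains no
    further names.

    Conversely, let [I] be a submodel of [I1] in which every element keeps only one
    chosen witness per existential concept of [K1], so that [I] has finite outdegree.
    The pairs of a [K2]-type and an element of [I] admitting no finite obstruction to
    a homomorphism form a model of [K2] that maps to [I].  Such a pair exists at every
    individual as soon as the entailed UCQs bound the depth of obstructions, but
    successors along roles outside the signature may be mapped anywhere, and the depth
    of obstructions need not be bounded over all of [I].  One therefore replaces [I]
    by another model of [K1]: label each element by its [K1]-type and its set of
    obstructed [K2]-types, choose one representative for each of the finitely many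
    labels, and glue finite pieces of [I] of depth [N] starting at representatives.
    The same types are obstructed, now with a uniform bound on the depth, and a single
    UCQ (the disjunction of all CQs of bounded size that fail in the glued model)
    gives suitable types for the individuals. *)

(** * Finite bounds *)

Lemma In_mem (T : eqType) (x : T) (s : seq T) : List.In x s <-> x \in s.
Proof.
elim: s => //= y s [IH1 IH2]; rewrite inE; split.
  by case=> [->|/IH1 ->]; rewrite ?eqxx ?orbT.
by case/orP => [/eqP ->|/IH2]; [left|right].
Qed.

Lemma fin_bound (T : finType) (P : T -> nat -> Prop) :
    (forall t m n, m <= n -> P t m -> P t n) ->
  exists N, forall t n, P t n -> P t N.
Proof.
move=> mono.
have [t|f Pf] := @choice T nat (fun t m => forall n, P t n -> P t m).
  have [[m Pm]|nP] := pselect (exists m, P t m); first by exists m.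
  by exists 0 => n Pn; case: nP; exists n.
exists (\max_t f t) => t n /Pf; apply: mono.
exact: leq_bigmax.
Qed.

Fixpoint sublists (T : Type) (s : seq T) : seq (seq T) :=
  if s is x :: s' then sublists s' ++ map (cons x) (sublists s') else [:: [::]].

Lemma filter_sublists (T : Type) (P : pred T) (s : seq T) :
  List.In (filter P s) (sublists s).
Proof.
elim: s => [|x s IH] /=; first by left.
by apply/List.in_app_iff; case: (P x); [right; apply: List.in_map|left].
Qed.

Lemma sublists_sub (T : Type) (s p : seq T) :
  List.In p (sublists s) -> forall x, List.In x p -> List.In x s.
Proof.
elim: s p => [|y s IH] p /=; first by case=> // <-.
case/List.in_app_iff => [/IH H x /H|]; first by right.
case/List.in_map_iff => p' [<- /IH H] x /= [->|/H]; by [left|right].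
Qed.

Fixpoint words (T : finType) (n : nat) : seq (seq T) :=
  if n is n'.+1 then [::] :: [seq i :: w | i <- enum T, w <- words T n']
  else [:: [::]].

Lemma mem_words (T : finType) (n : nat) (w : seq T) :
  size w <= n -> w \in words T n.
Proof.
elim: n w => [|n IH] [|i w] //= /IH wn; rewrite inE /=.
by apply/allpairsP; exists (i, w); rewrite mem_enum.
Qed.

(** * Concepts over top, names, negation, conjunction and existentials *)

(** Value restrictions and disjunctions are expressed through negation, which leaves existentials as
    the only modal case for types. *)
Inductive core : Type :=
| KTop
| KName of concept_name
| KNot of core
| KAnd of core & core
| KEx of role_name & core.

HB.instance Definition _ := gen_eqMixin core.

Fixpoint core_of (C : concept) : core :=
  match C with
  | CTop => KTop
  | CBot => KNot KTop
  | CName A => KName A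
  | CNot C => KNot (core_of C)
  | CAnd C D => KAnd (core_of C) (core_of D)
  | COr C D => KNot (KAnd (KNot (core_of C)) (KNot (core_of D)))
  | CEx R C => KEx R (core_of C)
  | CAll R C => KNot (KEx R (KNot (core_of C)))
  end.

Fixpoint cext (I : interp) (C : core) (u : elt I) : Prop :=
  match C with
  | KTop => dom u
  | KName A => cint A u
  | KNot C => dom u /\ ~ cext C u
  | KAnd C D => cext C u /\ cext D u
  | KEx R C => exists v, rint R u v /\ cext C v
  end.

Lemma ext_dom (I : interp) C u : ext I C u -> dom u.
Proof.
elim: C u => //=.
- by move=> A u /cint_dom.
- by move=> C _ u [].
- by move=> C IHC D _ u [/IHC].
- by move=> C IHC D IHD u [/IHC|/IHD].
- by move=> R C _ u [v [/rint_dom[]]].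
- by move=> R C _ u [].
Qed.

Lemma cext_dom (I : interp) C (u : elt I) : cext C u -> dom u.
Proof.
elim: C u => //=.
- by move=> A u /cint_dom.
- by move=> C _ u [].
- by move=> C IHC D _ u [/IHC].
- by move=> R C _ u [v [/rint_dom[]]].
Qed.

Lemma cext_core_of (I : interp) C (u : elt I) : cext (core_of C) u <-> ext I C u.
Proof.
elim: C u => //=.
- by move=> u; split=> // -[].
- by move=> C IH u; split=> -[du nC]; split=> // /IH.
- by move=> C IHC D IHD u; split=> -[/IHC ? /IHD ?].
- move=> C IHC D IHD u; split.
    case=> du nCD; apply: contrapT => nU; apply: nCD; split; split=> //.
      by move=> /IHC ?; apply: nU; left.
    by move=> /IHD ?; apply: nU; right.
  move=> CD; split; first by case: CD => /ext_dom.
  by case: CD => [/IHC ? [[]]|/IHD ? [_ []]].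
- by move=> R C IH u; split=> -[v [Rv /IH ?]]; exists v.
- move=> R C IH u; split=> -[du H]; split=> //.
    move=> v Rv; apply: contrapT => nC; apply: H; exists v; split=> //.
    by split=> [|/IH //]; case: (rint_dom Rv).
  by case=> v [/H /IH ? []].
Qed.

(** * Subconcepts and the closure of a KB *)

Definition children (C : core) : seq core :=
  match C with
  | KNot C => [:: C]
  | KAnd C D => [:: C; D]
  | KEx _ C => [:: C]
  | _ => [::]
  end.

Definition sub_closed (s : seq core) : Prop :=
  forall C, C \in s -> {subset children C <= s}.

Fixpoint subs (C : core) : seq core :=
  C :: match C with
       | KNot C => subs C
       | KAnd C D => subs C ++ subs D
       | KEx _ C => subs C
       | _ => [::]
       end.

Lemma mem_subs C : C \in subs C.
Proof. by case: C => *; rewrite inE eqxx. Qed.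

Lemma sub_closed_cat s t : sub_closed s -> sub_closed t -> sub_closed (s ++ t).
Proof.
move=> Hs Ht C; rewrite mem_cat => /orP[/Hs|/Ht] H D /H; rewrite mem_cat => ->;
by rewrite ?orbT.
Qed.

Lemma sub_closed_cons C s :
  {subset children C <= s} -> sub_closed s -> sub_closed (C :: s).
Proof.
move=> HC Hs D; rewrite inE => /predU1P[->|/Hs H] E.
  by move=> /HC Es; rewrite inE Es orbT.
by move=> /H Es; rewrite inE Es orbT.
Qed.

Lemma sub_closed_flatten (ss : seq (seq core)) :
  (forall s, List.In s ss -> sub_closed s) -> sub_closed (flatten ss).
Proof.
elim: ss => [|s ss IH] //= H; apply: sub_closed_cat; first by apply: H; left.
by apply: IH => t ts; apply: H; right.
Qed.

Lemma sub_closed_subs C : sub_closed (subs C).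
Proof.
elim: C => /=.
- by apply: sub_closed_cons.
- by move=> A; apply: sub_closed_cons.
- move=> C IH; apply: sub_closed_cons => // D; rewrite inE => /eqP ->.
  exact: mem_subs.
- move=> C IHC D IHD; apply: sub_closed_cons; last exact: sub_closed_cat.
  by move=> E; rewrite !inE mem_cat => /orP[]/eqP ->; rewrite mem_subs ?orbT.
- move=> R C IH; apply: sub_closed_cons => // D; rewrite inE => /eqP ->.
  exact: mem_subs.
Qed.

Definition abox_names (f : assertion) : seq core :=
  if f is CAssert A _ then [:: KName A] else [::].

(** The ABox names are included so that types decide the assertions [A(a)]. *)
Definition cl (K : kb) : seq core :=
  flatten [seq subs (core_of p.1) ++ subs (core_of p.2) | p <- kb_tbox K] ++
  flatten [seq abox_names f | f <- kb_abox K].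

Lemma sub_closed_cl K : sub_closed (cl K).
Proof.
apply: sub_closed_cat; apply: sub_closed_flatten => s.
  case/List.in_map_iff => p [<- _].
  by apply: sub_closed_cat; apply: sub_closed_subs.
by case/List.in_map_iff => -[A a|R a b] [<- _] //=; apply: sub_closed_cons.
Qed.

Lemma cl_tbox K C D : List.In (C, D) (kb_tbox K) ->
  (core_of C \in cl K) /\ (core_of D \in cl K).
Proof.
move=> CD; rewrite /cl !mem_cat.
suff H : {subset subs (core_of C) ++ subs (core_of D) <=
          flatten [seq subs (core_of p.1) ++ subs (core_of p.2) | p <- kb_tbox K]}.
  by split; rewrite H // mem_cat mem_subs ?orbT.
elim: (kb_tbox K) CD => //= p T IH [->|/IH H] E Es; rewrite mem_cat.
  by rewrite Es.
by rewrite (H _ Es) orbT.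
Qed.

Lemma cl_abox K A a : List.In (CAssert A a) (kb_abox K) -> KName A \in cl K.
Proof.
rewrite /cl mem_cat => H; apply/orP; right.
by elim: (kb_abox K) H => //= f s IH [->|/IH H];
  rewrite /= ?mem_cat ?inE ?eqxx ?H ?orbT.
Qed.

(** * Types *)

(** One truth value per position of [cl K] makes types a [finType]; positions holding the same
    concept agree on realized types. *)
Definition type_of (K : kb) : finType := {ffun 'I_(size (cl K)) -> bool}.

Definition tp (K : kb) (I : interp) (u : elt I) : type_of K :=
  [ffun i : 'I_(size (cl K)) => `[< cext (nth KTop (cl K) i) u >]].

Definition tmem (K : kb) (t : type_of K) (C : core) : Prop :=
  exists i : 'I_(size (cl K)), nth KTop (cl K) i = C /\ t i.

Lemma tmem_cl K (t : type_of K) C : tmem t C -> C \in cl K.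
Proof. by case=> i [<- _]; apply: mem_nth. Qed.

Lemma tmem_tp K (I : interp) (u : elt I) C :
  C \in cl K -> tmem (tp K u) C <-> cext C u.
Proof.
move=> Ccl; split=> [[i [<-]]|Cu]; first by rewrite ffunE => /asboolP.
have Ci : index C (cl K) < size (cl K) by rewrite index_mem.
exists (Ordinal Ci); rewrite ffunE /= nth_index //; split=> //.
exact/asboolP.
Qed.

Definition tmodel (I : interp) (K : kb) : Prop :=
  forall C D, List.In (C, D) (kb_tbox K) ->
    forall u : elt I, ext I C u -> ext I D u.

(** Types are semantic: Boolean coherence and the TBox inclusions are inherited from an
    interpretation in which the type occurs. *)
Definition realized (K : kb) (t : type_of K) : Prop :=
  exists (I : interp) (u : elt I), [/\ tmodel I K, dom u & t = tp K u].

Definition compat (K : kb) (R : role_name) (t t' : type_of K) : Prop :=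
  exists (I : interp) (u v : elt I),
    [/\ tmodel I K, rint R u v, t = tp K u & t' = tp K v].

Lemma compat_realized K R (t t' : type_of K) : compat R t t' -> realized t'.
Proof.
by move=> [I [u [v [mI Ruv _ ->]]]]; exists I, v; split=> //; case: (rint_dom Ruv).
Qed.

Lemma compat_ex K R (t t' : type_of K) C :
  KEx R C \in cl K -> compat R t t' -> tmem t' C -> tmem t (KEx R C).
Proof.
move=> RC [I [u [v [_ Ruv -> ->]]]] Cv; apply/(tmem_tp _ RC); exists v.
by split=> //; apply/(tmem_tp _ (tmem_cl Cv)).
Qed.

(** Truth lemma, by induction on the concept: Boolean cases are read off an interpretation realizing
    the type, and the last two hypotheses are the existential case. *)
Lemma type_truth K (J : interp) (t : elt J -> type_of K) :
    (forall x, dom x -> realized (t x)) ->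
    (forall A x, dom x -> KName A \in cl K -> cint A x <-> tmem (t x) (KName A)) ->
    (forall R C x y, KEx R C \in cl K -> rint R x y ->
       tmem (t y) C -> tmem (t x) (KEx R C)) ->
    (forall R C x, dom x -> tmem (t x) (KEx R C) ->
       exists y, rint R x y /\ tmem (t y) C) ->
  forall C x, C \in cl K -> dom x -> cext C x <-> tmem (t x) C.
Proof.
move=> real nameE exI exE; elim=> [|A|C IH|C IHC D IHD|R C IH] x Ccl dx /=.
- by have [I [u [_ du ->]]] := real x dx; split=> // _; apply/tmem_tp.
- exact: nameE.
- have C'cl : C \in cl K by apply: (sub_closed_cl Ccl); rewrite inE.
  have [I [u [_ du tu]]] := real x dx.
  move: (IH x C'cl dx); rewrite tu !tmem_tp //= => H.
  by split=> -[_ nC]; split=> // /H.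
- have C'cl : C \in cl K by apply: (sub_closed_cl Ccl); rewrite inE eqxx.
  have D'cl : D \in cl K by apply: (sub_closed_cl Ccl); rewrite !inE eqxx orbT.
  have [I [u [_ du tu]]] := real x dx.
  by move: (IHC x C'cl dx) (IHD x D'cl dx); rewrite tu !tmem_tp //= => -> ->.
- have C'cl : C \in cl K by apply: (sub_closed_cl Ccl); rewrite inE.
  split=> [[y [Rxy Cy]]|/(exE _ _ _ dx) [y [Rxy Cy]]].
    by apply: exI Rxy _ => //; apply/IH => //; apply: cext_dom Cy.
  by exists y; split=> //; apply/IH => //; case: (rint_dom Rxy).
Qed.

Lemma type_truth_tmodel K (J : interp) (t : elt J -> type_of K) :
    (forall x, dom x -> realized (t x)) ->
    (forall C x, C \in cl K -> dom x -> cext C x <-> tmem (t x) C) ->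
  tmodel J K.
Proof.
move=> real truth C D CD x Cx; have dx := ext_dom Cx.
have [Ccl Dcl] := cl_tbox CD.
have [I [u [mI du tu]]] := real x dx.
move: (truth _ _ Dcl dx) (truth _ _ Ccl dx); rewrite tu !tmem_tp // !cext_core_of.
by move=> -> /iffLR /(_ Cx); apply: mI.
Qed.

Lemma model_tmodel I K : model I K -> tmodel I K.
Proof. by case. Qed.

Lemma tp_realized K (I : interp) (u : elt I) :
  tmodel I K -> dom u -> realized (tp K u).
Proof. by exists I, u. Qed.

Lemma ind_assertion K a : a \in ind K ->
  exists2 f, List.In f (kb_abox K) & a \in assertion_inds f.
Proof.
rewrite /ind; elim: (kb_abox K) => //= f s IH.
rewrite mem_cat => /orP[|/IH [g gs ag]]; first by exists f => //; left.
by exists g => //; right.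
Qed.

Lemma assertion_ind K f a :
  List.In f (kb_abox K) -> a \in assertion_inds f -> a \in ind K.
Proof.
rewrite /ind; elim: (kb_abox K) => //= g s IH [->|/IH H] af.
  by rewrite mem_cat af.
by rewrite mem_cat H ?orbT.
Qed.

Lemma ind_dom K (I : interp) a : model I K -> a \in ind K -> dom (named I a).
Proof.
move=> [_ mA] /ind_assertion [[A b|R b c] /mA /=].
  by move=> /cint_dom Ab; rewrite inE => /eqP ->.
by move=> /rint_dom[db dc]; rewrite !inE => /orP[]/eqP ->.
Qed.

(** * Submodels of finite outdegree *)

Definition ex_witness (I : interp) (C : core) (u : elt I) : elt I :=
  if C is KEx R D then
    if pselect (exists v, rint R u v /\ cext D v) is left e then projT1 (cid e)
    else u
  else u.

Lemma ex_witnessP (I : interp) R C (u : elt I) : cext (KEx R C) u ->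
  rint R u (ex_witness (KEx R C) u) /\ cext C (ex_witness (KEx R C) u).
Proof. by move=> H; rewrite /ex_witness; case: pselect => // e; case: cid. Qed.

Lemma ex_witness_dom (I : interp) C (u : elt I) : dom u -> dom (ex_witness C u).
Proof.
move=> du; case: C => //= R C; case: pselect => // e.
by case: cid => v /= [/rint_dom[]].
Qed.

Definition finite_outdegree (I : interp) : Prop :=
  forall u : elt I, exists (T : finType) (f : T -> elt I),
    forall R v, rint R u v -> exists i, v = f i.

(** The second summand retains the targets of role assertions, so that thinning preserves the
    ABox. *)
Definition successor (K : kb) (I : interp) (u : elt I)
    (i : 'I_(size (cl K)) + 'I_(size (kb_abox K))) : elt I :=
  match i with
  | inl i => ex_witness (nth KTop (cl K) i) u
  | inr j => if nth (CAssert 0 0) (kb_abox K) j is RAssert _ _ b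
             then named I b else u
  end.

Definition thin (K : kb) (I : interp) : interp.
Proof.
refine (@Interp (anon I) (@dom I) (@cint I)
  (fun R u v => rint R u v /\ exists i, v = successor (K := K) u i)
  (@dom_nonempty I) (@cint_dom I) _).
by move=> R u v [/rint_dom].
Defined.

Lemma thin_finite K I : finite_outdegree (thin K I).
Proof.
move=> u; exists ('I_(size (cl K)) + 'I_(size (kb_abox K)))%type.
by exists (@successor K I u) => R v [].
Qed.

Lemma In_nth (T : Type) (x0 x : T) (s : seq T) :
  List.In x s -> exists2 i, i < size s & nth x0 s i = x.
Proof.
elim: s => //= y s IH [->|/IH[i si <-]]; first by exists 0.
by exists i.+1.
Qed.

(** Elements keep their types from [I]: deleting edges makes no new existential true, and the chosen
    witnesses keep the old ones true. *)
Lemma thin_model K I : model I K -> model (thin K I) K.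
Proof.
move=> mI; have tI := model_tmodel mI; split; last first.
  case=> [A a|R a b] /= H; first exact: mI.2 H.
  split; first exact: mI.2 H.
  have [j js jE] := In_nth (CAssert 0 0) H.
  by exists (inr (Ordinal js)); rewrite /= jE.
have real (x : elt (thin K I)) : dom x -> realized (tp K (x : elt I)).
  by move=> dx; exists I, x.
apply: (@type_truth_tmodel K (thin K I) (fun x => tp K (x : elt I))) => //.
apply: type_truth => //.
- by move=> A x dx Acl; rewrite tmem_tp.
- move=> R C x y RC [Rxy _] Cy; apply: compat_ex Cy => //.
  by exists I, x, y; split.
- move=> R C x dx RC; have RCcl := tmem_cl RC.
  have /ex_witnessP[Rxy Cy] := iffLR (tmem_tp _ RCcl) RC.
  have Ci : index (KEx R C) (cl K) < size (cl K) by rewrite index_mem.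
  exists (ex_witness (KEx R C) (x : elt I)); split; last first.
    by apply/tmem_tp => //; apply: (sub_closed_cl RCcl); rewrite inE.
  by split=> //; exists (inl (Ordinal Ci)); rewrite /= nth_index.
Qed.

(** * Obstructions to mapping a type into an interpretation *)

Definition local_ok (S : signature) (K : kb) (J : interp) (t : type_of K)
    (e : elt J) : Prop :=
  forall A, sig_concepts S A -> tmem t (KName A) -> cint A e.

(* [good n t e]: a witness tree of depth [n] for [t] maps into [J] with its root
   sent to [e]; successors along roles outside [S] may be mapped anywhere. *)
Fixpoint good (S : signature) (K : kb) (J : interp) (n : nat) (t : type_of K)
    (e : elt J) : Prop :=
  if n is n'.+1 then
    local_ok S t e /\
    forall R C, tmem t (KEx R C) -> exists (t' : type_of K) (e' : elt J),
      [/\ compat R t t', tmem t' C, dom e', sig_roles S R -> rint R e e'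
        & good S n' t' e']
  else True.

(* [bad D n t e] is the failure of [good] within [n] steps along roles of [S]
   only, the types of [D] being assumed to map nowhere. *)
Fixpoint bad (S : signature) (K : kb) (J : interp) (D : {set type_of K})
    (n : nat) (t : type_of K) (e : elt J) : Prop :=
  if n is n'.+1 then
    ~ local_ok S t e \/
    exists R C, tmem t (KEx R C) /\
      ((sig_roles S R /\ forall (t' : type_of K) (e' : elt J),
          compat R t t' -> tmem t' C -> rint R e e' -> bad S D n' t' e') \/
       (~ sig_roles S R /\ forall t' : type_of K,
          compat R t t' -> tmem t' C -> t' \in D))
  else False.

Lemma goodS S K (J : interp) n (t : type_of K) (e : elt J) :
  good S n.+1 t e -> good S n t e.
Proof.
elim: n t e => // n IH t e [lok H]; split=> // R C /H [t' [e' [? ? ? ? /IH ?]]].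
by exists t', e'.
Qed.

Lemma good_le S K (J : interp) m n (t : type_of K) (e : elt J) :
  m <= n -> good S n t e -> good S m t e.
Proof. by move=> /subnK <-; elim: (n - m) => // k IH /goodS. Qed.

Lemma badS S K (J : interp) D n (t : type_of K) (e : elt J) :
  bad S D n t e -> bad S D n.+1 t e.
Proof.
elim: n t e => // n IH t e [|[R [C [RC H]]]]; first by left.
right; exists R, C; split=> //; case: H => [[SR H]|]; [left|by right].
by split=> // t' e' c Ct' Re; apply/IH/H.
Qed.

Lemma bad_le S K (J : interp) D m n (t : type_of K) (e : elt J) :
  m <= n -> bad S D m t e -> bad S D n t e.
Proof. by move=> /subnK <-; elim: (n - m) => // k IH /IH /badS. Qed.

Lemma bad_sub S K (J : interp) (D D' : {set type_of K}) n t (e : elt J) :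
  D \subset D' -> bad S D n t e -> bad S D' n t e.
Proof.
move=> /subsetP DD'; elim: n t e => // n IH t e [|[R [C [RC H]]]]; first by left.
right; exists R, C; split=> //; case: H => -[SR H]; [left|right]; split=> //.
  by move=> t' e' c Ct' Re; apply/IH/H.
by move=> t' c Ct'; apply/DD'/H.
Qed.

(** Depths add up: at most [m] levels lead to a violated name or to a type of [D], which fails
    within [k] more levels. *)
Lemma bad_not_good S K (J : interp) (D : {set type_of K}) k m t (e : elt J) :
    (forall t' (e' : elt J), t' \in D -> dom e' -> ~ good S k t' e') ->
  bad S D m t e -> ~ good S (k + m) t e.
Proof.
move=> HD; elim: m t e => // m IH t e; rewrite addnS /=.
case=> [nl [] //|[R [C [RC H]]] [_ /(_ _ _ RC)]] [t' [e' [c Ct' de' Re g]]].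
case: H => -[SR H]; first by apply: IH g; apply: H; auto.
by apply: (HD t' e') => //; [exact: H|apply: good_le g; rewrite leq_addr].
Qed.

Definition bad_set S K (J : interp) (D : {set type_of K}) (e : elt J) :
    {set type_of K} := [set t | `[< exists n, bad S D n t e >]].

Lemma bad_setP S K (J : interp) (D : {set type_of K}) (e : elt J) t :
  t \in bad_set S D e <-> exists n, bad S D n t e.
Proof. by rewrite inE; split=> /asboolP. Qed.

Definition dead S K (J : interp) (D : {set type_of K}) : {set type_of K} :=
  [set t | `[< forall e : elt J, dom e -> t \in bad_set S D e >]].

Lemma deadP S K (J : interp) (D : {set type_of K}) t :
  t \in dead S J D <-> forall e : elt J, dom e -> t \in bad_set S D e.
Proof. by rewrite inE; split=> /asboolP. Qed.

Lemma dead_mono S K (J : interp) :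
  {homo @dead S K J : D D' / D \subset D'}.
Proof.
move=> D D' DD'; apply/subsetP => t /deadP H; apply/deadP => e /H.
by move/bad_setP => [n /(bad_sub DD') b]; apply/bad_setP; exists n.
Qed.

(** Types obstructed everywhere may obstruct others through roles outside [S], hence a least fixed
    point. *)
Definition dead_types S K (J : interp) : {set type_of K} := fixset (@dead S K J).

Lemma dead_typesK S K (J : interp) : dead S J (dead_types S K J) = dead_types S K J.
Proof. exact: fixsetK (@dead_mono S K J). Qed.

(* Bounded obstructions at every stage of the iteration defining [dead_types]
   accumulate to a bounded depth. *)
Lemma dead_types_not_good S K (I J : interp) M :
    (forall (D : {set type_of K}) t, t \in dead S I D ->
       forall e : elt J, dom e -> bad S D M t e) ->
  forall t (e : elt J), t \in dead_types S K I -> dom e ->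
    ~ good S (#|type_of K| * M) t e.
Proof.
move=> HM; rewrite /dead_types /fixset.
elim: #|type_of K| => [|n IH] t e /=; first by rewrite inE.
move=> /HM H /H; rewrite mulSn addnC; exact: bad_not_good.
Qed.

(* König's lemma: with finite outdegree, an element at which no finite
   obstruction exists has successors at which none exists. *)
Lemma not_bad_step S K (I : interp) (t : type_of K) (e : elt I) R C :
    finite_outdegree I -> let D := dead_types S K I in
    t \notin bad_set S D e -> tmem t (KEx R C) ->
  exists (t' : type_of K) (e' : elt I),
    [/\ compat R t t', tmem t' C, dom e', sig_roles S R -> rint R e e'
      & t' \notin bad_set S D e'].
Proof.
move=> fin D /negP nb RC; apply: contrapT => nex; apply: nb; apply/bad_setP.
have [SR|nSR] := pselect (sig_roles S R); last first.
  (* Every candidate type is obstructed at all elements, so it lies in [D] because [D] is a fixed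
     point of [dead]; depth 1 is then enough. *)
  exists 1; right; exists R, C; split=> //; right; split=> // t' c Ct'.
  rewrite /D -dead_typesK; apply/deadP => e' de'; apply/negPn/negP => nb'.
  by apply: nex; exists t', e'.
have [T [f fP]] := fin e.
(* A uniform depth for the finitely many pairs of a type and a successor of [e]. *)
have [|N HN] := @fin_bound (type_of K * T)%type
    (fun p n => bad S D n p.1 (f p.2)); first by move=> ? ? ?; exact: bad_le.
exists N.+1; right; exists R, C; split=> //; left; split=> // t' e' c Ct' Re.
have [i ei] := fP _ _ Re; rewrite ei in Re *.
have [/bad_setP [n /(HN (t', i))]//|nb'] := boolP (t' \in bad_set S D (f i)).
by case: nex; exists t', (f i); split=> //; case: (rint_dom Re).
Qed.

(** * Models glued from finite pieces of a model *)

Definition origin (I : interp) (x : ind_name + elt I * nat) : elt I :=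
  match x with inl a => named I a | inr p => p.1 end.

(** Individuals carry no fuel, so each anonymous successor of an individual is a representative with
    fuel [N]. *)
Definition fuel (I : interp) (x : ind_name + elt I * nat) : nat :=
  if x is inr p then p.2 else 0.

Definition refuel (I : interp) (rep : elt I -> elt I) (N k : nat) (d : elt I) :
    elt I * nat :=
  if k is k'.+1 then (d, k') else (rep d, N).

Definition glued_dom (K : kb) (I : interp) (N : nat)
    (x : ind_name + elt I * nat) : Prop :=
  match x with inl a => a \in ind K | inr p => dom p.1 /\ p.2 <= N end.

(* An anonymous element [(d, k)] behaves as [d] for [k] further steps; a successor
   reached with no fuel left is replaced by its representative with fuel [N]. *)
Definition glued (K : kb) (I : interp) (rep : elt I -> elt I) (N : nat)
    (mI : model I K) : interp.
Proof.
refine (@Interp (elt I * nat)%type (glued_dom K N)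
  (fun A x => glued_dom K N x /\ cint A (origin x))
  (fun R x y => [/\ glued_dom K N x, glued_dom K N y &
     match y with
     | inl b => if x is inl a then rint R (named I a) (named I b) else False
     | inr p => exists2 d, rint R (origin x) d & p = refuel rep N (fuel x) d
     end]) _ _ _).
- by case: (dom_nonempty I) => d dd; exists (inr (d, 0)).
- by move=> A x [].
- by move=> R x y [].
Defined.

Lemma origin_dom K (I : interp) N x :
  model I K -> glued_dom K N x -> dom (@origin I x).
Proof. by move=> mI; case: x => [a|[d k]] /= => [/(ind_dom mI)|[]]. Qed.

Lemma glued_rint K (I : interp) rep N (mI : model I K) R x y :
    @rint (glued rep N mI) R x y ->
  exists2 d, rint R (@origin I x) d & origin y = d \/ y = inr (rep d, N).
Proof.
case=> _ _; case: y => [b|p].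
  by case: x => // a Rab; exists (named I b) => //; left.
case=> d Rd ->; exists d => //; rewrite /refuel.
by case: (fuel x) => [|k]; [right|left].
Qed.

(** Each element has the type of its origin; passing to a representative does not change the type,
    so compatibility along edges survives. *)
Lemma glued_model K (I : interp) rep N (mI : model I K) :
    (forall d, dom d -> dom (rep d) /\ tp K (rep d) = tp K d) ->
  model (glued rep N mI) K.
Proof.
move=> repP; have tI := model_tmodel mI; split; last first.
  case=> [A a|R a b] H.
    have aK : a \in ind K by apply: assertion_ind H _; rewrite inE.
    by split=> //; apply: (mI.2 _ H).
  by split=> /=; rewrite ?(assertion_ind H) ?inE ?eqxx ?orbT //; apply: (mI.2 _ H).
have real (x : elt (glued rep N mI)) : dom x -> realized (tp K (@origin I x)).
  by move=> dx; apply: tp_realized => //; apply: origin_dom dx.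
apply: (@type_truth_tmodel K (glued rep N mI) (fun x => tp K (@origin I x))) => //.
apply: type_truth => //.
- by move=> A x dx Acl; rewrite tmem_tp //=; split=> [[]|].
- move=> R C x y RC /[dup] [[_ dy _]] /glued_rint [d Rd yE] Cy.
  apply: compat_ex Cy => //; exists I, (@origin I x), d; split=> //.
  case: yE => [->//|->] /=; apply: (repP d _).2; by case: (rint_dom Rd).
- move=> R C x dx RC; have RCcl := tmem_cl RC.
  have Ccl : C \in cl K by apply: (sub_closed_cl RCcl); rewrite inE.
  have [d [Rd Cd]] := iffLR (tmem_tp _ RCcl) RC.
  have [_ dd] := rint_dom Rd.
  have [drd trd] := repP d dd.
  exists (inr (refuel rep N (fuel x) d)); split; last first.
    by rewrite /refuel; case: (fuel x) => [|k] /=; rewrite ?trd; apply/tmem_tp.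
  split=> //; last by exists d.
  rewrite /refuel; case E: (fuel x) => [|k] //=; split=> //.
  by case: x dx E {RC Rd} => //= p [_ +] E; rewrite E => /ltnW.
Qed.

(* [rep] has the same obstructions as the element it replaces, and they occur
   within [N] steps at representatives and at named individuals; hence they
   occur within a bounded number of steps everywhere in the glued model. *)
Lemma glued_bad S K1 K2 (I : interp) rep N (mI : model I K1)
    (D : {set type_of K2}) :
    (forall d, dom d -> bad_set S D (rep d) = bad_set S D d) ->
    (forall d t, dom d -> t \in bad_set S D (rep d) -> bad S D N t (rep d)) ->
    (forall a t, a \in ind K1 -> t \in bad_set S D (named I a) ->
       bad S D N t (named I a)) ->
  forall t (x : elt (glued rep N mI)), dom x ->
    t \in bad_set S D (@origin I x) -> bad S D (N + N).+1 t x.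
Proof.
move=> repE repN indN.
have lok t (x : elt (glued rep N mI)) : ~ local_ok S t (@origin I x) ->
    ~ local_ok S t x.
  by move=> nl l; apply: nl => A SA At; have [] := l A SA At.
(* Depth [n] inspects at most [n - 1] steps, so the obstruction is settled before any replacement
   occurs. *)
have block n t d k : n <= k.+1 -> bad S D n t d ->
    bad S D n t (inr (d, k) : elt (glued rep N mI)).
  elim: n t d k => // n IH t d k nk [nl|[R [C [RC H]]]].
    by left; apply: lok.
  right; exists R, C; split=> //; case: H => -[SR H]; [left|by right].
  split=> // t' [b|p] c Ct' [_ _] //= [d' Rd' ->].
  have := H _ _ c Ct' Rd'; case: k nk => [|k] nk /=; last exact: IH.
  by case: n nk {IH H}.
have repB t d : dom d -> t \in bad_set S D d ->
    bad S D N t (inr (rep d, N) : elt (glued rep N mI)).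
  by move=> dd; rewrite -repE // => /(repN _ _ dd); apply: block.
(* Induction on the fuel, not on the depth at [d]: after at most [k] steps the next one reaches a
   representative, where depth [N] suffices. *)
have anonB k t d : t \in bad_set S D d ->
    bad S D (N + k).+1 t (inr (d, k) : elt (glued rep N mI)).
  elim: k t d => [|k IH] t d /bad_setP[[//|n]] [nl|[R [C [RC H]]]];
    try (by left; apply: lok);
    right; exists R, C; split=> //; (case: H => -[SR H]; [left|by right]);
    split=> // t' [b|p] c Ct' [_ _] //= [d' Rd' ->] /=.
    rewrite addn0; apply: repB; first by case: (rint_dom Rd').
    by apply/bad_setP; exists n; apply: H Rd'.
  rewrite addnS; apply: IH; apply/bad_setP; exists n; exact: H Rd'.
(* A path either stays among individuals, using up [n], or leaves for a representative, where depth
   [N] suffices. *)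
have namedB n t a : bad S D n t (named I a) ->
    bad S D (N + n) t (inl a : elt (glued rep N mI)).
  elim: n t a => // n IH t a; rewrite addnS => -[nl|[R [C [RC H]]]].
    by left; apply: lok.
  right; exists R, C; split=> //; case: H => -[SR H]; [left|by right].
  split=> // t' [b|p] c Ct' [_ _] => [Rab|[d' Rd' ->]].
    by apply: IH; apply: H Rab.
  apply: bad_le (leq_addr _ _) _; apply: repB; first by case: (rint_dom Rd').
  by apply/bad_setP; exists n; apply: H Rd'.
move=> t [a|[d k]] dx; first by move=> /(indN _ _ dx) /namedB /badS.
by move=> /(anonB k); apply: bad_le; rewrite ltnS leq_add2l; case: dx.
Qed.

(** Obstructed types are recorded relative to every [D], since each stage of the iteration defining
    [dead_types] uses the bound. *)
Definition label S K1 K2 (I : interp) (d : elt I) :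
    (type_of K1 * {ffun {set type_of K2} -> {set type_of K2}})%type :=
  (tp K1 d, [ffun D => bad_set S D d]).

(* Finitely many labels make finitely many representatives suffice, so that a
   common bound [N] exists. *)
Lemma bounded_model S K1 K2 (I : interp) (mI : model I K1) :
  exists (rep : elt I -> elt I) (N M : nat),
    model (glued rep N mI) K1 /\
    forall (D : {set type_of K2}) t (x : elt (glued rep N mI)), dom x ->
      t \in bad_set S D (@origin I x) -> bad S D M t x.
Proof.
have [d0 dd0] := dom_nonempty I.
pose lab := @label S K1 K2 I.
(* [r] picks an element for each label; labels that do not occur get the default [d0]. *)
have [l|r rP] := @choice _ (elt I) (fun l e =>
    forall d, dom d -> lab d = l -> dom e /\ lab e = l).
  have [[d [dd <-]]|nex] := pselect (exists d, dom d /\ lab d = l).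
    by exists d.
  by exists d0 => d dd dl; case: nex; exists d.
pose rep d := r (lab d).
have repP d : dom d -> dom (rep d) /\ lab (rep d) = lab d.
  by move=> dd; apply: rP dd _.
have repE d (D : {set type_of K2}) : dom d -> bad_set S D (rep d) = bad_set S D d.
  by move=> /repP[_ [_ /ffunP /(_ D)]]; rewrite !ffunE.
pose elt_of (i : (type_of K1 * {ffun {set type_of K2} -> {set type_of K2}}) +
    'I_(size (ind K1))) : elt I :=
  match i with inl l => r l | inr j => named I (nth 0 (ind K1) j) end.
have [|N HN] := @fin_bound
    (((type_of K1 * {ffun {set type_of K2} -> {set type_of K2}}) +
      'I_(size (ind K1))) * ({set type_of K2} * type_of K2))%type
    (fun p n => bad S p.2.1 n p.2.2 (elt_of p.1)).
  by move=> ? ? ?; exact: bad_le.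
exists rep, N, (N + N).+1; split.
  by apply: glued_model => d /repP[? [? _]].
move=> D; apply: glued_bad.
- by move=> d; apply: repE.
- by move=> d t dd /bad_setP [n]; apply: (HN (inl (lab d), (D, t))).
- move=> a t aK /bad_setP [n].
  have ai : index a (ind K1) < size (ind K1) by rewrite index_mem.
  by have := HN (inr (Ordinal ai), (D, t)) n; rewrite /= nth_index.
Qed.

(** * Queries with finitely many variables *)

HB.instance Definition _ n := gen_eqMixin (qvar n).
HB.instance Definition _ n := gen_eqMixin (atom n).

Definition all_atoms (n : nat) (cs : seq concept_name) (rs : seq role_name)
    (V : seq (qvar n)) : seq (atom n) :=
  [seq CAtom A z | A <- cs, z <- V] ++
  [seq RAtom p.1 p.2 z' | p <- [seq (R, z) | R <- rs, z <- V], z' <- V].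

Lemma mem_all_CAtom n cs rs (V : seq (qvar n)) A z :
  A \in cs -> z \in V -> CAtom A z \in all_atoms cs rs V.
Proof.
by move=> Ac zV; rewrite mem_cat; apply/orP; left; apply/allpairsP; exists (A, z).
Qed.

Lemma mem_all_RAtom n cs rs (V : seq (qvar n)) R z z' :
  R \in rs -> z \in V -> z' \in V -> RAtom R z z' \in all_atoms cs rs V.
Proof.
move=> Rr zV z'V; rewrite mem_cat; apply/orP; right.
apply/allpairsP; exists ((R, z), z'); split=> //.
by apply/allpairsP; exists (R, z).
Qed.

(* The query is the disjunction of all CQs built from the atoms in [L] that fail
   in [J]. *)
Lemma finite_partial_hom S K1 K2 (J : interp) (L : seq (atom (size (ind K2)))) :
    let a := in_tuple (ind K2) in
    ucq_entails S K1 K2 -> model J K1 ->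
  exists2 I2 : interp, model I2 K2 &
    forall pi : qvar (size (ind K2)) -> elt I2,
      (forall z, dom (pi z)) ->
      (forall i, pi (XVar i) = named I2 (tnth a i)) ->
    exists pi' : qvar (size (ind K2)) -> elt J,
      [/\ forall z, dom (pi' z),
          forall i, pi' (XVar i) = named J (tnth a i)
        & forall t, t \in L -> atom_over S t -> sat_atom pi t -> sat_atom pi' t].
Proof.
move=> a ent mJ; apply: contrapT => nex.
pose L' := [seq t <- L | `[< atom_over S t >]].
pose q := [seq p <- sublists L' | `[< ~ sat_cq J p a >]].
have qP p : List.In p q <-> List.In p (sublists L') /\ ~ sat_cq J p a.
  by rewrite /q List.filter_In; split=> -[? /asboolP].
have [|||_ /(_ J mJ) [p /qP[_ nJ] /nJ]//] := ent _ q a.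
- move=> p /qP[/sublists_sub pL _] t /pL /In_mem.
  by rewrite mem_filter => /andP[/asboolP].
- by move=> x.
(* A model of [K2] falsifying [q] is as required: the CQ [p] of atoms true under [pi] holds there,
   so it is no disjunct of [q] and must hold in [J]. *)
move=> I2 mI2; apply: contrapT => nq; apply: nex; exists I2 => // pi dpi pix.
pose p := [seq t <- L' | `[< sat_atom pi t >]].
have pI : sat_cq I2 p a.
  by exists pi; split=> // t /In_mem; rewrite mem_filter => /andP[/asboolP].
have [[pi' [dpi' pix' H]]|nJ] := pselect (sat_cq J p a); last first.
  by case: nq; exists p => //; apply/qP; split=> //; apply: filter_sublists.
exists pi'; split=> // t tL tS tpi; apply/H/In_mem.
by rewrite !mem_filter tL andbT; apply/andP; split; apply/asboolP.
Qed.

Definition core_names (C : core) : seq concept_name :=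
  if C is KName A then [:: A] else [::].
Definition core_roles (C : core) : seq role_name :=
  if C is KEx R _ then [:: R] else [::].
Definition assertion_roles (f : assertion) : seq role_name :=
  if f is RAssert R _ _ then [:: R] else [::].

Definition kb_names (K : kb) : seq concept_name :=
  flatten [seq core_names C | C <- cl K].
Definition kb_roles (K : kb) : seq role_name :=
  flatten [seq core_roles C | C <- cl K] ++
  flatten [seq assertion_roles f | f <- kb_abox K].

Lemma kb_namesP K A : KName A \in cl K -> A \in kb_names K.
Proof. by move=> H; apply/flatten_mapP; exists (KName A); rewrite ?inE. Qed.

Lemma kb_roles_cl K R C : KEx R C \in cl K -> R \in kb_roles K.
Proof.
move=> H; rewrite mem_cat; apply/orP; left.
by apply/flatten_mapP; exists (KEx R C); rewrite ?inE.
Qed.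

Lemma kb_roles_abox K R a b :
  List.In (RAssert R a b) (kb_abox K) -> R \in kb_roles K.
Proof.
rewrite mem_cat => H; apply/orP; right.
by elim: (kb_abox K) H => //= f s IH [->|/IH H];
  rewrite /= ?mem_cat ?inE ?eqxx ?H ?orbT.
Qed.

(* The variables name the nodes of the witness trees of depth [n] below the
   individuals and below one arbitrary element. *)
Lemma good_of_ucq_entails S K1 K2 (J : interp) n :
    ucq_entails S K1 K2 -> model J K1 ->
  exists2 I2 : interp, model I2 K2 &
    [/\ forall a, a \in ind K2 ->
          dom (named J a) /\ good S n (tp K2 (named I2 a)) (named J a),
        forall R a b, List.In (RAssert R a b) (kb_abox K2) -> sig_roles S R ->
          rint R (named J a) (named J b)
      & exists (t : type_of K2) (e : elt J),
          [/\ realized t, dom e & good S n t e]].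
Proof.
move=> ent mJ.
pose m := size (ind K2); pose c := size (cl K2).
(* [Some i] is the root at an individual, [None] the arbitrary root; only the empty word at an
   individual gives an answer variable. *)
pose var (r : option 'I_m) (w : seq 'I_c) : qvar m :=
  if r is Some i then if w is [::] then XVar i else YVar m (pickle (r, w))
  else YVar m (pickle (r, w)).
pose V := [seq var r w | r <- enum {: option 'I_m}, w <- words 'I_c n].
have varV r w : size w <= n -> var r w \in V.
  by move=> wn; apply/allpairsP; exists (r, w); rewrite mem_enum mem_words.
have [I2 mI2 H] := finite_partial_hom (all_atoms (kb_names K2) (kb_roles K2) V) ent mJ.
exists I2 => //.
have [d0 dd0] := dom_nonempty I2.
pose root (r : option 'I_m) : elt I2 :=
  if r is Some i then named I2 (tnth (in_tuple (ind K2)) i) else d0.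
have root_dom r : dom (root r).
  by case: r => [i|] //=; apply: ind_dom mI2 _; apply: mem_tnth.
(* A word lists the positions in [cl K2] of the existentials whose witnesses are followed. *)
pose walk (u : elt I2) (w : seq 'I_c) :=
  foldl (fun u (i : 'I_c) => ex_witness (nth KTop (cl K2) i) u) u w.
have walk_dom u w : dom u -> dom (walk u w).
  by elim: w u => //= i w IH u du; apply/IH/ex_witness_dom.
pose pi (z : qvar m) : elt I2 :=
  match z with
  | XVar i => root (Some i)
  | YVar k => if @unpickle (option 'I_m * seq 'I_c)%type k is Some (r, w)
              then walk (root r) w else d0
  end.
have pi_var r w : pi (var r w) = walk (root r) w.
  by case: r w => [i|] [|j w] //; rewrite /pi /var pickleK.
have pi_dom z : dom (pi z).
  by case: z => [i|k] /=; [exact: (root_dom (Some i))|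
     case: unpickle => // -[r w]; exact: walk_dom].
have [//|pi' [pi'_dom pi'_x pi'_atom]] := H pi pi_dom.
have goodP k r w : size w + k <= n ->
    good S k (tp K2 (pi (var r w))) (pi' (var r w)).
  elim: k w => // k IH w wk.
  have wn : size w <= n by apply: leq_trans wk; apply: leq_addr.
  split.
    move=> A SA At; have Acl := tmem_cl At.
    apply: (pi'_atom (CAtom A (var r w))) => //.
      by apply: mem_all_CAtom; [exact: kb_namesP|exact: varV].
    exact/(tmem_tp _ Acl).
  move=> R C RC; have RCcl := tmem_cl RC.
  have Ccl : C \in cl K2 by apply: (sub_closed_cl RCcl); rewrite inE.
  have ip : index (KEx R C) (cl K2) < c by rewrite index_mem.
  have := ex_witnessP (iffLR (tmem_tp _ RCcl) RC).
  set v := ex_witness _ _.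
  have -> : v = pi (var r (rcons w (Ordinal ip))).
    by rewrite !pi_var /walk foldl_rcons /= nth_index // /v pi_var.
  move=> [Rv Cv]; have swk : size (rcons w (Ordinal ip)) + k <= n.
    by rewrite size_rcons addSn -addnS.
  exists (tp K2 (pi (var r (rcons w (Ordinal ip))))),
    (pi' (var r (rcons w (Ordinal ip)))); split=> //.
  - by eexists I2, _, _; split; [exact: model_tmodel|exact: Rv| |].
  - exact/tmem_tp.
  - move=> SR; apply: (pi'_atom (RAtom R _ _)) => //.
    apply: mem_all_RAtom; [exact: kb_roles_cl RCcl|exact: varV|apply: varV].
    by apply: leq_trans swk; apply: leq_addr.
  - exact: IH.
have ind_var a : a \in ind K2 -> exists i : 'I_m,
    pi (var (Some i) [::]) = named I2 a /\ pi' (var (Some i) [::]) = named J a.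
  move=> aK; have ai : index a (ind K2) < m by rewrite index_mem.
  have E : tnth (in_tuple (ind K2)) (Ordinal ai) = a.
    by rewrite (tnth_nth 0) /= nth_index.
  by exists (Ordinal ai); rewrite /= pi'_x E.
split.
- move=> a /ind_var [i [E E']]; rewrite -E -E'; split=> //.
  exact: goodP.
- move=> R a b ab SR.
  have [i [Ei Ei']] : exists i : 'I_m, pi (var (Some i) [::]) = named I2 a /\
      pi' (var (Some i) [::]) = named J a.
    by apply/ind_var/(assertion_ind ab); rewrite inE eqxx.
  have [j [Ej Ej']] : exists i : 'I_m, pi (var (Some i) [::]) = named I2 b /\
      pi' (var (Some i) [::]) = named J b.
    by apply/ind_var/(assertion_ind ab); rewrite !inE eqxx orbT.
  rewrite -Ei' -Ej'; apply: (pi'_atom (RAtom R _ _)) => //.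
    by apply: mem_all_RAtom; [exact: kb_roles_abox ab|exact: varV|exact: varV].
  by rewrite /= in Ei Ej *; rewrite Ei Ej; apply: (mI2.2 _ ab).
(* The root [None] provides a pair even when [K2] has no individuals. *)
- exists (tp K2 (pi (var None [::]))), (pi' (var None [::])); split=> //.
    by apply: tp_realized; [exact: model_tmodel|exact: pi_dom].
  exact: goodP.
Qed.

(** * The model of types without obstruction *)

Definition pair_of (K : kb) (I : interp) (ta : ind_name -> type_of K)
    (u : ind_name + type_of K * elt I) : type_of K * elt I :=
  match u with inl a => (ta a, named I a) | inr p => p end.

Definition pair_dom (K : kb) (I : interp) (X : type_of K -> elt I -> Prop)
    (u : ind_name + type_of K * elt I) : Prop :=
  match u with inl a => a \in ind K | inr p => X p.1 p.2 end.

(** Roles outside [S] constrain only the types, while roles of [S] must also be edges of [I]; the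
    second projection is thereby the homomorphism. *)
Definition pair_interp (S : signature) (K : kb) (I : interp)
    (ta : ind_name -> type_of K) (X : type_of K -> elt I -> Prop)
    (hX : exists t e, X t e) : interp.
Proof.
refine (@Interp (type_of K * elt I)%type (pair_dom X)
  (fun A u => pair_dom X u /\ tmem (pair_of ta u).1 (KName A))
  (fun R u v => [/\ pair_dom X u, pair_dom X v,
     compat R (pair_of ta u).1 (pair_of ta v).1
     & sig_roles S R -> rint R (pair_of ta u).2 (pair_of ta v).2]) _ _ _).
- by case: hX => t [e Xte]; exists (inr (t, e)).
- by move=> A u [].
- by move=> R u v [].
Defined.

Lemma pair_interp_model S K (I I2 : interp) (X : type_of K -> elt I -> Prop)
    (hX : exists t e, X t e) :
    model I2 K ->
    (forall a, a \in ind K -> X (tp K (named I2 a)) (named I a)) ->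
    (forall R a b, List.In (RAssert R a b) (kb_abox K) -> sig_roles S R ->
       rint R (named I a) (named I b)) ->
    (forall t e, X t e -> [/\ realized t, dom e & local_ok S t e]) ->
    (forall t e R C, X t e -> tmem t (KEx R C) -> exists t' e',
       [/\ compat R t t', tmem t' C, sig_roles S R -> rint R e e' & X t' e']) ->
  let J := pair_interp S (fun a => tp K (named I2 a)) hX in
  model J K /\ hom_embeddable S K J I.
Proof.
move=> mI2 Xind Rind Xok Xstep; set ta := fun a => _; move=> J.
have XP (u : elt J) : dom u -> X (pair_of ta u).1 (pair_of ta u).2.
  by case: u => [a /Xind|[t e]].
have real (u : elt J) : dom u -> realized (pair_of ta u).1.
  by move=> /XP /Xok [].
split; [split|].
- apply: (@type_truth_tmodel K J (fun u => (pair_of ta u).1)) => //.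
  apply: type_truth => //.
  + by move=> A x dx Acl; split=> [[]|].
  + by move=> R C x y RC [_ _ c _]; apply: compat_ex.
  + move=> R C x dx RC.
    have [t' [e' [c Ct' Re Xe]]] := Xstep _ _ _ _ (XP x dx) RC.
    by exists (inr (t', e')).
- case=> [A a|R a b] H.
    have aK : a \in ind K by apply: assertion_ind H _; rewrite inE.
    split=> //=; apply/tmem_tp; [exact: cl_abox H|exact: (mI2.2 _ H)].
  split=> /=; rewrite ?(assertion_ind H) ?inE ?eqxx ?orbT //.
    exists I2, (named I2 a), (named I2 b); split=> //; first exact: model_tmodel.
    exact: (mI2.2 _ H).
  exact: Rind H.
- exists (fun u : elt J => (pair_of ta u).2); split=> //.
  + by move=> u /XP /Xok [].
  + by move=> A u SA [du]; have [_ _] := Xok _ _ (XP u du); apply.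
  + by move=> R u v SR [_ _ _]; apply.
Qed.

(** * The two directions of the equivalence *)

Lemma ucq_entails_embeds S K1 K2 (I1 : interp) :
    ucq_entails S K1 K2 -> model I1 K1 ->
  exists2 I2 : interp, model I2 K2 & hom_embeddable S K2 I2 I1.
Proof.
move=> ent mI1; pose I := thin K1 I1.
have mI : model I K1 by exact: thin_model.
have fin : finite_outdegree I by exact: thin_finite.
have [rep [N [M [mJ boundM]]]] := bounded_model S K2 mI.
set J := glued rep N mI in mJ boundM.
pose D := dead_types S K2 I.
have deadM : forall (t : type_of K2) (e : elt J), t \in D -> dom e ->
    ~ good S (#|type_of K2| * M) t e.
  apply: dead_types_not_good => E t /deadP H e de; apply: boundM => //.
  by apply: H; apply: origin_dom de.
pose X (t : type_of K2) (e : elt I) :=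
  [/\ realized t, dom e & t \notin bad_set S D e].
(* An obstruction at the origin would recur at [x] within depth [M], ending at worst in types of
   [D], which fail within the remaining depth. *)
have goodX t (x : elt J) : realized t -> dom x ->
    good S (#|type_of K2| * M + M) t x -> X t (@origin I x).
  move=> rt dx g; split=> //; first exact: origin_dom dx.
  by apply/negP => /(boundM _ _ _ dx) b; apply: bad_not_good b g.
have [I2 mI2 [indI2 RI2 [t0 [e0 [rt0 de0 g0]]]]] :=
  good_of_ucq_entails (#|type_of K2| * M + M) ent mJ.
have hX : exists t e, X t e by exists t0, (@origin I e0); apply: goodX.
have [||||mJ2 [h [h1 h2 h3 h4]]] := @pair_interp_model S K2 I I2 X hX mI2.
- move=> a aK; have [da ga] := indI2 a aK.
  apply: (goodX _ (named J a)) => //; apply: tp_realized; first exact: model_tmodel.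
  exact: ind_dom aK.
- by move=> R a b ab SR; have [] := RI2 _ _ _ ab SR.
- move=> t e [rt de nb]; split=> //; apply: contrapT => nl.
  by move/negP: nb; apply; apply/bad_setP; exists 1; left.
- move=> t e R C [rt de nb] RC.
  have [t' [e' [c Ct' de' Re nb']]] := not_bad_step fin nb RC.
  by exists t', e'; split=> //; split=> //; apply: compat_realized c.
exists (pair_interp S (fun a => tp K2 (named I2 a)) hX) => //.
(* [I] differs from [I1] only by having fewer edges, so a homomorphism into [I] is one into [I1]. *)
by exists h; split=> // R u v SR Ruv; have [] := h3 R u v SR Ruv.
Qed.

Lemma embeds_ind S K1 K2 :
    consistent K1 ->
    (forall I1 : interp, model I1 K1 ->
       exists2 I2 : interp, model I2 K2 & hom_embeddable S K2 I2 I1) ->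
  {subset ind K2 <= ind K1}.
Proof.
move=> [I mI] H a aK.
(* The named elements of this model are exactly those of [ind K1]. *)
have mJ : model (glued id 0 mI) K1 by apply: glued_model.
have [I2 mI2 [h [hdom _ _ hind]]] := H _ mJ.
by have := hdom _ (ind_dom mI2 aK); rewrite hind.
Qed.

Theorem theorem6 (K1 K2 : kb) (S : signature)
    (hK1 : consistent K1) (hK2 : consistent K2) :
  ucq_entails S K1 K2 <->
  (forall I1 : interp, model I1 K1 ->
     exists2 I2 : interp, model I2 K2 & hom_embeddable S K2 I2 I1).
Proof.
split=> [ent I1|H n q a qS aK2 ent]; first exact: ucq_entails_embeds.
split=> [x /aK2|I1 mI1]; first exact: embeds_ind hK1 H x.
have [I2 mI2 [h [hdom hA hR hind]]] := H I1 mI1.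
have [p pq [pi [pidom pix pip]]] := ent I2 mI2.
exists p => //; exists (h \o pi); split=> /=.
- by move=> z; apply: hdom.
- by move=> i; rewrite pix hind // aK2 // mem_tnth.
- by move=> t tp; move: (qS p pq t tp) (pip t tp); case: t {tp} => [A z|R z z'] /=;
    [apply: hA|apply: hR].
Qed.
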